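(* Let $\alpha\in(0,1)$ and $\vartheta\in\Theta$. Let the multiple test procedures $\varphi_{(n)}$, $n\in\mathbb N$, be based on a critical value function $\rho\le f_\alpha^{-1}$ (i.e. on the critical values $\alpha_{i:n}=\rho(i/n)$, $i=1,\dots,n$), and assume (T1), (T2), (D1), (D2), (D3), (I1), (I2), (A1) (for every $n$), $\lim_{n\to\infty}\zeta_n=\zeta\in[0,1]$, where $\zeta_n=n_0(n)/n$, and $$\forall\varepsilon>0:\quad\liminf_{n\to\infty}\inf_{\varepsilon\le t\le1}\bigl(t-\hat F_n(\rho(t))\bigr)>0\qquad P_\vartheta\text{-almost surely}.$$ Then $$\limsup_{n\to\infty}\mathrm{FDR}_\vartheta(\varphi_{(n)})\le\zeta\limsup_{x\downarrow0}q(x)=\zeta q(0)=\zeta\overline q(0)\le\zeta\alpha.$$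
   Context: Let $(\mathcal X,\mathcal A,\{P_\vartheta:\vartheta\in\Theta\})$ be a statistical experiment, $(H_i)_{i\in\mathbb N}$ a sequence of null hypotheses with $\varnothing\neq H_i\subset\Theta$, and $(p_i)_{i\in\mathbb N}$ a sequence of $p$-values, i.e. measurable maps $p_i:\mathcal X\to[0,1]$ with $0<P_\vartheta(p_i\le x)\le x$ for all $\vartheta\in H_i$, $i\in\mathbb N$, $x\in(0,1]$. Put $\mathbb N_n=\{1,\dots,n\}$, $I_0(\vartheta)=\{i\in\mathbb N:\vartheta\in H_i\}$, $I_1(\vartheta)=\mathbb N\setminus I_0(\vartheta)$, $I_{n,j}(\vartheta)=I_j(\vartheta)\cap\mathbb N_n$, $n_j(n)=|I_{n,j}(\vartheta)|$, $j=0,1$. $\hat F_n$ is the empirical cumulative distribution function of $p_1,\dots,p_n$. The space is assumed rich enough to carry the following probability measures (not necessarily belonging to $\{P_\vartheta\}$). For $I_0\subseteq\mathbb N$, the Dirac-uniform configuration $P_{I_0}$, under which the $p_i$, $i\in I_0$, are i.i.d. uniform on $[0,1]$ and $p_i=0$ almost surely for $i\notin I_0$. For $\vartheta\in\Theta$ and $i\in I_0(\vartheta)$, a measure $P_{\vartheta^i}$ under which $(p_k)_{k\in\mathbb N}$ has the same distribution as $(p_k^i)_{k\in\mathbb N}$ under $P_\vartheta$, where $p^i_k=p_k$ for $k\ne i$ and $p^i_i\equiv0$. A (non-randomized) multiple test procedure for $H_1,\dots,H_n$ is $\varphi_{(n)}=(\varphi_1,\dots,\varphi_n)$, a $\{0,1\}^n$-valued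 function of $p_1,\dots,p_n$, where $\varphi_i=1$ means that $H_i$ is rejected. $V_n=|\{i\in\mathbb N_n:\varphi_i=1,\ \vartheta\in H_i\}|$, $R_n=|\{i\in\mathbb N_n:\varphi_i=1\}|$, and $\mathrm{FDR}_\vartheta(\varphi_{(n)})=\mathbb E_\vartheta[V_n/(R_n\vee 1)]$. A critical value function is a nondecreasing continuous $\rho:[0,1]\to[0,1]$ with $\rho(0)=0$ and $\rho>0$ on $(0,1]$; it does not depend on $n$. Define $q(x)=\rho(x)/x$ for $x\in(0,1]$, $q(0)=\limsup_{x\downarrow0}q(x)$ (finite), and $\overline q(x)=\max_{0\le t\le x}q(t)$, $x\in[0,1]$. Define $f_\alpha^{-1}(t)=\dfrac{\alpha t}{1-(1-\alpha)t}$, $t\in[0,1]$. Conditions: (T1) For all $i\in\mathbb N_n$: $p_i\le\alpha_{1:n}$ implies $\varphi_i=1$. (T2) For all $j\in\mathbb N_n$: $R_n=j$ implies that for all $i\in\mathbb N_n$: $\varphi_i=1\Leftrightarrow p_i\le\alpha_{j:n}$. (D1) For all $\vartheta\in\Theta$, $j\in\mathbb N_n$, $i\in I_{n,0}(\vartheta)$: $P_\vartheta(R_n\ge j\mid p_i\le t)$ is nonincreasing in $t\in(0,\alpha_{j:n}]$. (D2) For all $\vartheta\in\Theta$, $j\in\mathbb N_n$, $i\in I_{n,0}(\vartheta)$, $t\in(0,\alpha_{j:n}]$: $P_\vartheta(R_n\ge j\mid p_i\le t)\le P_{\vartheta^i}(R_n\ge j)$. (D3) For all $\vartheta\in\Theta$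 and $i\in I_{n,0}(\vartheta)$: $p_i$ is uniformly distributed on $[0,1]$ under $P_\vartheta$. (I1) For all $\vartheta\in\Theta$: the $p_i$, $i\in I_{n,0}(\vartheta)$, are i.i.d. under $P_\vartheta$. (I2) For all $\vartheta\in\Theta$: $(p_i:i\in I_{n,0}(\vartheta))$ and $(p_i:i\in I_{n,1}(\vartheta))$ are stochastically independent random vectors under $P_\vartheta$. (A1) If $(p_1,\dots,p_n)$ is stochastically not greater under $\vartheta_1$ than under $\vartheta_2$, then $\varphi_{(n)}$ is stochastically not greater under $\vartheta_2$ than under $\vartheta_1$. Here $\vartheta_1,\vartheta_2$ range over $\Theta$ and also over the indices of the auxiliary measures $P_{\vartheta^i}$ and $P_{I_0}$ above; ''stochastically not greater'' is the usual multivariate stochastic order (expectations of all nondecreasing functions are ordered whenever they exist). *)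

(* Defs.v *)
(* Indices are shifted by one: hypothesis H_(k+1) and p-value p_(k+1) of the
   mathematical text are H k and p k, so that N_n = {1, ..., n} is {k | k < n}.
   Numbers of rejections and the index j of the critical value alpha_(j:n) are
   not shifted. *)
From HB Require Import structures.
From mathcomp Require Import all_boot all_order all_algebra.
From mathcomp Require Import finmap.
From mathcomp Require Import all_classical all_reals all_analysis.

Set Implicit Arguments.
Unset Strict Implicit.
Unset Printing Implicit Defensive.

Import Order.TTheory GRing.Theory Num.Theory.
Import numFieldNormedType.Exports.

Local Open Scope classical_set_scope.
Local Open Scope ring_scope.

Definition uniform01 (R : realType) (d : measure_display)
    (X : measurableType d) (Q : probability X R) (Y : {mfun X >-> R}) : Prop :=
  forall B : set R, measurable B ->
    distribution Q Y B = uniform_prob (@ltr01 R) B.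

Definition identically_distributed (R : realType) (d : measure_display)
    (X : measurableType d) (Q : probability X R)
    (I : set nat) (Y : nat -> {mfun X >-> R}) : Prop :=
  forall i k, I i -> I k -> forall B : set R, measurable B ->
    distribution Q (Y i) B = distribution Q (Y k) B.

Definition mutually_independent (R : realType) (d : measure_display)
    (X : measurableType d) (Q : probability X R)
    (I : set nat) (Y : nat -> {mfun X >-> R}) : Prop :=
  forall J : {fset nat}, [set` J] `<=` I ->
  forall B : nat -> set R, (forall i, measurable (B i)) ->
    Q (\bigcap_(i in [set` J]) (Y i @^-1` B i)) =
    (\prod_(i <- J) Q (Y i @^-1` B i))%E.

Definition independent_vectors (R : realType) (d d1 d2 : measure_display)
    (X : measurableType d) (E1 : measurableType d1) (E2 : measurableType d2)
    (Q : probability X R) (Y : X -> E1) (Z : X -> E2) : Prop :=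
  forall (A : set E1) (B : set E2), measurable A -> measurable B ->
    Q (Y @^-1` A `&` Z @^-1` B) = (Q (Y @^-1` A) * Q (Z @^-1` B))%E.

(* Only ever used with 0 < Q B. *)
Definition cond_prob (R : realType) (d : measure_display)
    (X : measurableType d) (Q : probability X R) (A B : set X) : R :=
  fine (Q (A `&` B)) / fine (Q B).

Definition tuple_le (disp : Order.disp_t) (T : porderType disp) (n : nat)
    (u v : n.-tuple T) : Prop :=
  forall i, (tnth u i <= tnth v i)%O.

(* Z under Q1 is stochastically not greater than Z under Q2, with respect to
   the order le on the values of Z. *)
Definition stoch_le (R : realType) (d d' : measure_display)
    (X : measurableType d) (E : measurableType d') (le : E -> E -> Prop)
    (Q1 Q2 : probability X R) (Z : X -> E) : Prop :=
  forall f : E -> R, measurable_fun setT f ->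
    (forall u v, le u v -> f u <= f v) ->
    Q1.-integrable setT (EFin \o (f \o Z)) ->
    Q2.-integrable setT (EFin \o (f \o Z)) ->
    ('E_Q1[f \o Z] <= 'E_Q2[f \o Z])%E.

(* The product sigma-algebra on R^nat (the library only provides the one on
   finite tuples). *)
Definition seq_measurable (R : realType) : set (set (nat -> R)) :=
  <<s \bigcup_(k in [set: nat])
        preimage_set_system setT (fun w : nat -> R => w k) measurable >>.

Definition is_pvalues (R : realType) (d : measure_display)
    (X : measurableType d) (Theta : Type) (P : Theta -> probability X R)
    (H : nat -> set Theta) (p : nat -> {mfun X >-> R}) : Prop :=
  (forall i x, 0 <= p i x <= 1) /\
  (forall theta i t, H i theta -> 0 < t <= 1 ->
    (0 < P theta [set x | (p i x <= t)%R] <= t%:E)%E).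

Definition is_dirac_uniform (R : realType) (d : measure_display)
    (X : measurableType d) (p : nat -> {mfun X >-> R})
    (I : set nat) (Q : probability X R) : Prop :=
  [/\ mutually_independent Q I p,
      forall i, I i -> uniform01 Q (p i)
    & forall i, ~ I i -> \forall x \ae Q, p i x = 0].

(* Q is P_(theta^i), for P0 = P_theta: the law of (p_k)_k under Q is that of
   (p_k^i)_k under P0. *)
Definition is_zeroed (R : realType) (d : measure_display)
    (X : measurableType d) (p : nat -> {mfun X >-> R})
    (P0 : probability X R) (i : nat) (Q : probability X R) : Prop :=
  forall B : set (nat -> R), seq_measurable B ->
    Q ((fun x k => p k x) @^-1` B) =
    P0 ((fun x k => if k == i then 0 else p k x) @^-1` B).

Definition pvec (R : realType) (d : measure_display) (X : measurableType d)
    (p : nat -> {mfun X >-> R}) (n : nat) (x : X) : n.-tuple R :=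
  [tuple p i x | i < n].

Definition subpvec (R : realType) (d : measure_display) (X : measurableType d)
    (p : nat -> {mfun X >-> R}) (n : nat) (I : {set 'I_n}) (x : X) :
    #|I|.-tuple R :=
  [tuple p (enum_val k) x | k < #|I|].

Definition true_nulls (Theta : Type) (H : nat -> set Theta) (n : nat)
    (theta : Theta) : {set 'I_n} :=
  [set i : 'I_n | `[< H i theta >]].

Definition zeta_ (R : realType) (Theta : Type) (H : nat -> set Theta)
    (theta : Theta) (n : nat) : R :=
  #|true_nulls H n theta|%:R / n%:R.

(* Empirical distribution function of p_1, ..., p_n. *)
Definition ecdf (R : realType) (d : measure_display) (X : measurableType d)
    (p : nat -> {mfun X >-> R}) (n : nat) (x : X) (t : R) : R :=
  #|[set i : 'I_n | p i x <= t]%SET|%:R / n%:R.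

(* A multiple test procedure for n hypotheses is a measurable function from the
   n p-values to {0,1}^n; component true means rejection. *)
Definition mtp (R : realType) (n : nat) : Type :=
  {mfun n.-tuple R >-> n.-tuple bool}.

Definition rejected (R : realType) (d : measure_display) (X : measurableType d)
    (p : nat -> {mfun X >-> R}) (n : nat) (phi : mtp R n) (x : X) : {set 'I_n} :=
  [set i : 'I_n | tnth (phi (pvec p n x)) i].

Definition nrej (R : realType) (d : measure_display) (X : measurableType d)
    (p : nat -> {mfun X >-> R}) (n : nat) (phi : mtp R n) (x : X) : nat :=
  #|rejected p phi x|.

Definition nfalse_rej (R : realType) (d : measure_display)
    (X : measurableType d) (Theta : Type) (H : nat -> set Theta)
    (p : nat -> {mfun X >-> R}) (n : nat) (phi : mtp R n) (theta : Theta)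
    (x : X) : nat :=
  #|rejected p phi x :&: true_nulls H n theta|.

Definition FDR (R : realType) (d : measure_display) (X : measurableType d)
    (Theta : Type) (P : Theta -> probability X R) (H : nat -> set Theta)
    (p : nat -> {mfun X >-> R}) (n : nat) (phi : mtp R n) (theta : Theta) :
    \bar R :=
  'E_(P theta)[fun x => (nfalse_rej H p phi theta x)%:R /
                        (maxn (nrej p phi x) 1)%:R].

(* Below, a j stands for the critical value alpha_(j:n), 1 <= j <= n. *)

Definition T1 (R : realType) (d : measure_display) (X : measurableType d)
    (p : nat -> {mfun X >-> R}) (n : nat) (phi : mtp R n) (a : nat -> R) : Prop :=
  forall (x : X) (i : 'I_n), p i x <= a 1%N -> i \in rejected p phi x.

Definition T2 (R : realType) (d : measure_display) (X : measurableType d)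
    (p : nat -> {mfun X >-> R}) (n : nat) (phi : mtp R n) (a : nat -> R) : Prop :=
  forall (x : X) (j : nat), (1 <= j <= n)%N -> nrej p phi x = j ->
  forall i : 'I_n, i \in rejected p phi x <-> p i x <= a j.

Definition D1 (R : realType) (d : measure_display) (X : measurableType d)
    (Theta : Type) (P : Theta -> probability X R) (H : nat -> set Theta)
    (p : nat -> {mfun X >-> R}) (n : nat) (phi : mtp R n) (a : nat -> R) : Prop :=
  forall (theta : Theta) (j : nat) (i : 'I_n),
    (1 <= j <= n)%N -> H i theta ->
  forall s t : R, 0 < s -> s <= t -> t <= a j ->
    cond_prob (P theta) [set x | (j <= nrej p phi x)%N] [set x | p i x <= t]
    <= cond_prob (P theta) [set x | (j <= nrej p phi x)%N] [set x | p i x <= s].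

Definition D2 (R : realType) (d : measure_display) (X : measurableType d)
    (Theta : Type) (P : Theta -> probability X R) (H : nat -> set Theta)
    (Pzero : Theta -> nat -> probability X R)
    (p : nat -> {mfun X >-> R}) (n : nat) (phi : mtp R n) (a : nat -> R) : Prop :=
  forall (theta : Theta) (j : nat) (i : 'I_n),
    (1 <= j <= n)%N -> H i theta ->
  forall t : R, 0 < t -> t <= a j ->
    ((cond_prob (P theta) [set x | (j <= nrej p phi x)%N]
        [set x | p i x <= t])%:E
     <= Pzero theta i [set x | (j <= nrej p phi x)%N])%E.

Definition D3 (R : realType) (d : measure_display) (X : measurableType d)
    (Theta : Type) (P : Theta -> probability X R) (H : nat -> set Theta)
    (p : nat -> {mfun X >-> R}) (n : nat) : Prop :=
  forall (theta : Theta) (i : 'I_n), H i theta -> uniform01 (P theta) (p i).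

Definition I1 (R : realType) (d : measure_display) (X : measurableType d)
    (Theta : Type) (P : Theta -> probability X R) (H : nat -> set Theta)
    (p : nat -> {mfun X >-> R}) (n : nat) : Prop :=
  forall theta : Theta,
    mutually_independent (P theta) [set i | (i < n)%N /\ H i theta] p /\
    identically_distributed (P theta) [set i | (i < n)%N /\ H i theta] p.

Definition I2 (R : realType) (d : measure_display) (X : measurableType d)
    (Theta : Type) (P : Theta -> probability X R) (H : nat -> set Theta)
    (p : nat -> {mfun X >-> R}) (n : nat) : Prop :=
  forall theta : Theta,
    independent_vectors (P theta)
      (subpvec p (true_nulls H n theta)) (subpvec p (~: true_nulls H n theta)).

(* The measures P_theta, P_(theta^i) with i in I_0(theta), and P_(I_0). *)
Definition model_measures (R : realType) (d : measure_display)
    (X : measurableType d) (Theta : Type) (P : Theta -> probability X R)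
    (H : nat -> set Theta) (Pzero : Theta -> nat -> probability X R)
    (PDU : set nat -> probability X R) (Q : probability X R) : Prop :=
  [\/ exists theta, Q = P theta,
      exists theta i, H i theta /\ Q = Pzero theta i
    | exists I, Q = PDU I].

Definition A1 (R : realType) (d : measure_display) (X : measurableType d)
    (Theta : Type) (P : Theta -> probability X R) (H : nat -> set Theta)
    (Pzero : Theta -> nat -> probability X R) (PDU : set nat -> probability X R)
    (p : nat -> {mfun X >-> R}) (n : nat) (phi : mtp R n) : Prop :=
  forall Q1 Q2 : probability X R,
    model_measures P H Pzero PDU Q1 -> model_measures P H Pzero PDU Q2 ->
    stoch_le (@tuple_le _ R n) Q1 Q2 (pvec p n) ->
    stoch_le (@tuple_le _ bool n) Q2 Q1 (fun x => phi (pvec p n x)).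

(* q takes extended real values only so that q(0), a limit superior, is defined
   without a finiteness proof; finiteness is part of is_cvf. *)
Definition q (R : realType) (rho : R -> R) (x : R) : \bar R :=
  if x == 0 then limf_esup (fun t => (rho t / t)%:E) 0^'+
  else (rho x / x)%:E.

Definition qbar (R : realType) (rho : R -> R) (x : R) : \bar R :=
  ereal_sup (q rho @` `[0, x]).

Definition is_cvf (R : realType) (rho : R -> R) : Prop :=
  [/\ {within `[0, 1], continuous rho},
      forall s t : R, 0 <= s -> s <= t -> t <= 1 -> rho s <= rho t,
      forall t : R, 0 <= t <= 1 -> 0 <= rho t <= 1,
      rho 0 = 0 /\ (forall t : R, 0 < t <= 1 -> 0 < rho t)
    & q rho 0 \is a fin_num].

Definition crit_val (R : realType) (rho : R -> R) (n j : nat) : R :=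
  rho (j%:R / n%:R).

Definition f_inv (R : realType) (alpha t : R) : R :=
  alpha * t / (1 - (1 - alpha) * t).

(* Main.v *)
Require Import Defs.
From HB Require Import structures.
From mathcomp Require Import all_boot all_order all_algebra.
From mathcomp Require Import all_classical all_reals all_analysis.
From mathcomp Require Import measurable_realfun ring lra.

Import Order.TTheory GRing.Theory Num.Theory.
Import numFieldNormedType.Exports.

(** Cut the false discovery rate at a small proportion eps of rejections.

    More than eps * n rejections become impossible in the limit.  By (T2), a
    sample with R_n = j satisfies F_n(rho(j / n)) = j / n, so t - F_n(rho(t))
    vanishes at t = j / n; the assumed asymptotic gap on [eps, 1] therefore
    forces R_n <= eps * n eventually, almost surely, and the event
    R_n > eps * n has probability tending to 0 ([cvg_many_rejections0]).  On
    that event V_n / R_n is bounded by 1.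

    With few rejections, the classical step-up argument applies to each true
    null hypothesis i separately.  Writing a_j for the critical values and
    C_j = P(R_n >= j | p_i <= a_j), the contribution of i is
    sum_j P(R_n = j, p_i <= a_j) / j, and
    P(R_n = j, p_i <= a_j) = P(p_i <= a_j) (C_j - P(R_n >= j + 1 | p_i <= a_j))
    is at most a_j (C_j - C_(j+1)), because conditional probabilities of many
    rejections decrease in the conditioning level (D1).  If rho(t) <= c t for
    t <= eps, then a_j / j <= c / n for the j that occur, and the sum
    telescopes to at most c / n ([null_contribution_le]).

    Adding up over the true null hypotheses gives
    FDR_n <= zeta_n c + P(R_n > eps n) ([FDR_le]), whose limit is zeta c.
    Since q(0) is the limit superior of rho(t) / t at 0, any c > q(0) is
    admissible for some eps > 0, and c decreases to q(0).  Finally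
    q(0) <= alpha because f_alpha^-1(t) / t tends to alpha at 0. *)

Local Open Scope classical_set_scope.
Local Open Scope ring_scope.

(** * Limits superior along a filter *)

Section limsup.
Context {T : choiceType} {U : filteredType T} {R : realType}.
Implicit Types (f g : U -> \bar R) (F : set_system U).
Local Open Scope ereal_scope.

Lemma limf_esup_lt_near f F l : Filter F ->
  limf_esup f F < l -> \forall x \near F, f x < l.
Proof.
move=> FF; rewrite limf_esupE => /ereal_inf_lt[_ [V FV <-]] supl.
near=> x; apply: le_lt_trans supl; apply: ereal_sup_ubound; exists x => //.
by near: x.
Unshelve. all: by end_near. Qed.

Lemma le_limf_esup f g F : Filter F ->
  (\forall x \near F, f x <= g x) -> limf_esup f F <= limf_esup g F.
Proof.
move=> FF fg; rewrite [leRHS]limf_esupE; apply: le_ereal_inf_tmp => _ [V FV <-].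
rewrite limf_esupE; apply: (@le_trans _ _
  (ereal_sup (f @` (V `&` [set x | f x <= g x])))).
  by apply: ereal_inf_lbound; exists (V `&` [set x | f x <= g x]) => //; exact: filterI.
apply: ge_ereal_sup => _ [x [Vx fgx] <-].
by apply: (le_trans fgx); apply: ereal_sup_ubound; exists x.
Qed.

Lemma limf_esup_le_near f F l : Filter F ->
  (\forall x \near F, f x <= l) -> limf_esup f F <= l.
Proof.
move=> FF fl; rewrite limf_esupE; apply: (@le_trans _ _
  (ereal_sup (f @` [set x | f x <= l]))).
  by apply: ereal_inf_lbound; exists [set x | f x <= l].
by apply: ge_ereal_sup => _ [x ? <-].
Qed.

End limsup.

(** * Measurability of events about rejections *)

Section multiple_testing.
Context {R : realType} {d : measure_display} {X : measurableType d}.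
Implicit Types (p : nat -> {mfun X >-> R}) (Q : probability X R).

(** The rejected set takes finitely many values, each determined by finitely
    many measurable coordinates, so that every event about it is measurable. *)
Lemma measurable_rejected_preimage p n (phi : mtp R n) (B : set {set 'I_n}) :
  measurable (rejected p phi @^-1` B).
Proof.
have mpvec : measurable_fun setT (pvec p n).
  apply/measurable_fun_tnthP => i.
  rewrite (_ : _ \o _ = p i); last by apply/funext => x; rewrite /= tnth_mktuple.
  exact: measurable_funP.
have mphi : measurable_fun setT (fun x => phi (pvec p n x)).
  exact: (measurableT_comp (measurable_funP phi) mpvec).
have mrej (i : 'I_n) (b : bool) :
    measurable [set x | (i \in rejected p phi x) = b].
  have /measurable_fun_tnthP /(_ i) := mphi.
  move=> /(_ measurableT [set b]); rewrite setTI.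
  rewrite (_ : _ @^-1` _ = [set x | (i \in rejected p phi x) = b]); first exact.
  by apply/seteqP; split => x /=; rewrite /rejected inE.
rewrite (_ : _ @^-1` _ = \bigcup_(S in B)
    \bigcap_(i in [set: 'I_n]) [set x | (i \in rejected p phi x) = (i \in S)]).
  apply: fin_bigcup_measurable => [|S _]; first exact: finite_finset.
  by apply: fin_bigcap_measurable => //; exact: finite_finset.
apply/seteqP; split => x /=; first by move=> Bx; exists (rejected p phi x).
move=> [S BS eqS]; rewrite (_ : rejected p phi x = S) //.
by apply/setP => i; exact: eqS.
Qed.

Lemma measurable_nrej p n (phi : mtp R n) (B : set nat) :
  measurable [set x | B (nrej p phi x)].
Proof.
exact: (measurable_rejected_preimage p n phi [set S : {set 'I_n} | B #|S|]).
Qed.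

Lemma measurable_pvalue_le p i t : measurable [set x | p i x <= t].
Proof.
rewrite (_ : [set x | p i x <= t] = p i @^-1` `]-oo, t]); last first.
  by apply/seteqP; split => x /=; rewrite in_itv.
exact: measurable_funPTI.
Qed.

(** * Finite-sample bound on the false discovery rate *)

(** The telescoping step: the conditional probabilities of at least j
    rejections, each taken at its own level [a j], decrease in j, and their
    weights [a j / j] are at most [c / n] as long as [j < m]. *)
Lemma null_contribution_le Q p n (phi : mtp R n) (a : nat -> R) (i : 'I_n)
    (m : nat) (c : R) :
    (forall t : R, 0 < t <= 1 -> (0 < Q [set x | (p i x <= t)%R] <= t%:E)%E) ->
    (forall j, (1 <= j <= n)%N -> 0 < a j <= 1) ->
    (forall j, (1 <= j < n)%N -> a j <= a j.+1) ->
    (forall j, (1 <= j <= n)%N -> forall s t : R, 0 < s -> s <= t -> t <= a j ->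
      cond_prob Q [set x | (j <= nrej p phi x)%N] [set x | p i x <= t] <=
      cond_prob Q [set x | (j <= nrej p phi x)%N] [set x | p i x <= s]) ->
    (1 <= m <= n)%N -> 0 <= c ->
    (forall j, (1 <= j < m)%N -> a j <= c * (j%:R / n%:R)) ->
  \sum_(1 <= j < m)
     j%:R^-1 * fine (Q [set x | nrej p phi x = j /\ p i x <= a j]) <= c / n%:R.
Proof.
move=> pv a01 ndeca d1 /andP[m0 mn] c0 ac.
pose A j := [set x | (j <= nrej p phi x)%N].
pose B j := [set x | p i x <= a j].
have mA j : measurable (A j) by exact: (measurable_nrej p n phi (fun k => (j <= k)%N)).
have mB j : measurable (B j) by exact: measurable_pvalue_le.
have fQ C : measurable C -> Q C \is a fin_num by move=> mC; exact: fin_num_measure.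
have cp01 C D : measurable C -> measurable D -> 0 <= cond_prob Q C D <= 1.
  move=> mC mD; rewrite /cond_prob.
  have QCD0 : 0 <= fine (Q (C `&` D)) by exact/fine_ge0/measure_ge0.
  have QD0 : 0 <= fine (Q D) by exact/fine_ge0/measure_ge0.
  have : fine (Q (C `&` D)) <= fine (Q D).
    apply: fine_le; [exact/fQ/measurableI|exact: fQ|].
    by apply: le_measure; rewrite ?inE//; exact: measurableI.
  move: QD0; rewrite le_eqVlt => /orP[/eqP <- _|QD0 CD]; first by rewrite invr0 mulr0 lexx ler01.
  by rewrite divr_ge0 ?(ltW QD0)// ler_pdivrMr// mul1r.
pose C j := cond_prob Q (A j) (B j).
have n0 : (0 : R) < n%:R by rewrite ltr0n (leq_trans m0).
have step j : (1 <= j < m)%N ->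
    j%:R^-1 * fine (Q [set x | nrej p phi x = j /\ p i x <= a j]) <=
    c / n%:R * (C j - C j.+1).
  move=> /andP[j0 jm].
  have jn : (j < n)%N by exact: leq_trans mn.
  have /andP[aj0 aj1] : 0 < a j <= 1 by rewrite a01// j0 ltnW.
  have /andP[QB0 QBa] : (0 < Q (B j) <= (a j)%:E)%E by apply: pv; rewrite aj0.
  have jR : (0 : R) < j%:R by rewrite ltr0n.
  have fQB0 : 0 < fine (Q (B j)).
    by rewrite fine_gt0// QB0/= (le_lt_trans QBa)// ltry.
  have fQBa : fine (Q (B j)) <= a j by rewrite -lee_fin fineK// fQ.
  have QE : fine (Q [set x | nrej p phi x = j /\ p i x <= a j]) =
      fine (Q (B j)) * (C j - cond_prob Q (A j.+1) (B j)).
    rewrite /C /cond_prob mulrBr !(mulrC (fine (Q (B j)))) !divfK ?gt_eqF//.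
    rewrite -fineB; [|exact/fQ/measurableI..].
    have -> : A j.+1 `&` B j = (A j `&` B j) `&` A j.+1.
      by apply/seteqP; split => x; rewrite /A /B /= => -[]; [move=> ?|case] => *;
        do ?split => //; exact: ltnW.
    congr fine; rewrite -measureD//; [|exact: measurableI|]; last first.
      by rewrite (le_lt_trans (probability_le1 _ _)) ?ltry//; exact: measurableI.
    congr (Q _); apply/seteqP; split => x; rewrite /A /B /=.
      by move=> [-> pa]; split; [split|rewrite ltnn].
    move=> [[jr pa] nr]; split => //; apply/eqP; rewrite eqn_leq jr andbT leqNgt.
    exact/negP.
  (* conditioning on the lower level a_j makes j + 1 rejections more likely than
     conditioning on a_(j+1) *)
  have Cmono : C j.+1 <= cond_prob Q (A j.+1) (B j).
    by apply: d1 => //; rewrite ?ndeca ?j0.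
  have E0 : 0 <= fine (Q [set x | nrej p phi x = j /\ p i x <= a j]).
    exact/fine_ge0/measure_ge0.
  have D0 : 0 <= C j - cond_prob Q (A j.+1) (B j) by move: E0; rewrite QE pmulr_rge0.
  rewrite QE mulrA; apply: (@le_trans _ _
    (c / n%:R * (C j - cond_prob Q (A j.+1) (B j)))).
    apply: ler_wpM2r => //; rewrite mulrC ler_pdivrMr// (le_trans fQBa)//.
    by rewrite -mulrA (mulrC n%:R^-1) ac// j0.
  have cn0 : 0 <= c / n%:R by exact: divr_ge0 c0 (ltW n0).
  by apply: ler_wpM2l => //; lra.
rewrite big_nat; apply: (le_trans (ler_sum _ step)).
rewrite -big_nat -mulr_sumr.
have -> : \sum_(1 <= j < m) (C j - C j.+1) = C 1%N - C m.
  rewrite -(opprB (C m)) -(telescope_sumr C m0) -sumrN.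
  by apply: eq_bigr => j _; rewrite opprB.
have /andP[_ C1] := cp01 _ _ (mA 1%N) (mB 1%N).
have /andP[Cm _] := cp01 _ _ (mA m) (mB m).
rewrite ler_piMr ?divr_ge0 ?(ltW n0)//; rewrite /C; lra.
Qed.

(** When 1 <= R = r < m, only the summands with j = r survive, and by (T2) they
    count the rejected true null hypotheses, each with weight 1 / r; when
    m <= R, the indicator alone dominates the proportion. *)
Lemma fdp_le (Theta : Type) (H : nat -> set Theta) p n (phi : mtp R n)
    (a : nat -> R) (theta : Theta) (m : nat) (x : X) :
  T2 p phi a ->
  (nfalse_rej H p phi theta x)%:R / (maxn (nrej p phi x) 1)%:R <=
  \sum_(i in true_nulls H n theta) \sum_(1 <= j < m)
     j%:R^-1 * \1_[set y | nrej p phi y = j /\ p i y <= a j] x +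
  \1_[set y | (m <= nrej p phi y)%N] x :> R.
Proof.
move=> t2; set r := nrej p phi x; set V := nfalse_rej _ _ _ _ _.
have VR : (V <= r)%N by rewrite subset_leq_card// finset.subsetIl.
have sum_ge0 (i : 'I_n) (s : seq nat) : 0 <=
    \sum_(j <- s) j%:R^-1 * \1_[set y | nrej p phi y = j /\ p i y <= a j] x :> R.
  by apply: sumr_ge0 => j _; rewrite mulr_ge0 ?invr_ge0// indicE.
have [r0|r0] := posnP r.
  have -> : V = 0%N by apply/eqP; rewrite -leqn0 -r0.
  by rewrite mul0r addr_ge0 ?indicE//; exact: sumr_ge0.
rewrite (maxn_idPl r0) [X in _ + X]indicE.
have rR : (0 : R) < r%:R by rewrite ltr0n.
have [mr|rm] := leqP m r.
  rewrite mem_set// [X in _ <= X]addrC; apply: ler_wpDr; first exact: sumr_ge0.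
  by rewrite ler_pdivrMr// mul1r ler_nat.
rewrite memNset /=; last by apply/negP; rewrite -ltnNge.
rewrite addr0 /V /nfalse_rej -sum1_card natr_sum mulr_suml.
rewrite (eq_bigl (fun i => (i \in true_nulls H n theta) && (i \in rejected p phi x)));
  last by move=> i; rewrite finset.in_setI andbC.
rewrite big_mkcondr /=; apply: ler_sum => i _; case: ifPn => [irej|_]; last exact: sum_ge0.
have rn : (1 <= r <= n)%N by rewrite r0 -[X in (_ <= X)%N]card_ord; exact: max_card.
rewrite (bigD1_seq r) ?iota_uniq ?mem_index_iota ?r0//= mul1r.
rewrite indicE mem_set ?mulr1; last by split => //; exact/(t2 x r rn erefl i).
apply: ler_wpDr => //; apply: sumr_ge0 => j _.
by rewrite mulr_ge0 ?invr_ge0// indicE.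
Qed.

(** The step-up bound controls samples with fewer than m rejections, and the
    remaining ones cost at most their probability. *)
Lemma FDR_le (Theta : Type) (P : Theta -> probability X R)
    (H : nat -> set Theta) p n (phi : mtp R n) (a : nat -> R) (theta : Theta)
    (m : nat) (c : R) :
    is_pvalues P H p -> T2 p phi a -> D1 P H p phi a ->
    (forall j, (1 <= j <= n)%N -> 0 < a j <= 1) ->
    (forall j, (1 <= j < n)%N -> a j <= a j.+1) ->
    (1 <= m <= n)%N -> 0 <= c ->
    (forall j, (1 <= j < m)%N -> a j <= c * (j%:R / n%:R)) ->
  (FDR P H p phi theta <=
   (zeta_ R H theta n * c)%:E + P theta [set x | (m <= nrej p phi x)%N])%E.
Proof.
move=> [_ pv] t2 d1 a01 ndeca mn c0 ac.
set Q := P theta; set N := true_nulls H n theta.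
pose E (i : 'I_n) j := [set x | nrej p phi x = j /\ p i x <= a j].
pose A := [set x | (m <= nrej p phi x)%N].
have mA : measurable A by exact: (measurable_nrej p n phi (fun k => (m <= k)%N)).
have mE i j : measurable (E i j).
  apply: measurableI; last exact: measurable_pvalue_le.
  exact: (measurable_nrej p n phi (fun k => k = j)).
have mEFin (B : set X) : measurable B ->
    measurable_fun [set: X] (EFin \o (\1_B : X -> R)).
  by move=> mB; apply/measurable_EFinP; exact: measurable_indic.
pose t (i : 'I_n) j x := ((j%:R^-1)%:E * (\1_(E i j) x : R)%:E)%E.
have mt i j : measurable_fun [set: X] (t i j : X -> \bar R).
  apply: (@emeasurable_funM _ _ _ _ (cst (j%:R^-1)%:E)) => //; exact: mEFin.
have t0 i j x : (0 <= t i j x)%E.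
  by rewrite /t mule_ge0// lee_fin ?invr_ge0// indicE.
have ms i : measurable_fun [set: X]
    ((fun x => \sum_(j <- index_iota 1 m) t i j x)%E : X -> \bar R).
  exact: emeasurable_sum.
have s0 i x : (0 <= \sum_(j <- index_iota 1 m) t i j x)%E.
  by apply: sume_ge0 => j _.
rewrite /FDR unlock; apply: (@le_trans _ _
  (\int[Q]_x (\sum_(i <- enum N) \sum_(j <- index_iota 1 m) t i j x +
     (\1_A x)%:E))%E).
  apply: ge0_le_integral => //.
  - apply/measurable_EFinP => _ B mB; rewrite setTI.
    exact: (measurable_rejected_preimage p n phi
      [set S : {set 'I_n} | B (#|S :&: N|%:R / (maxn #|S| 1)%:R)]).
  - by apply: emeasurable_funD; [exact: emeasurable_sum|exact: mEFin].
  - move=> x _; rewrite big_enum/=.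
    under eq_bigr do (under eq_bigr do rewrite /t -EFinM; rewrite sumEFin).
    by rewrite sumEFin -EFinD lee_fin; exact: fdp_le.
rewrite ge0_integralD//; last 3 first.
- by move=> x _; apply: sume_ge0 => i _.
- exact: emeasurable_sum.
- exact: mEFin.
rewrite integral_indic// setIT leeD2r//.
rewrite ge0_integral_sum// big_enum/=.
have intE (i : 'I_n) : (\int[Q]_x (\sum_(j <- index_iota 1 m) t i j x) =
    (\sum_(1 <= j < m) j%:R^-1 * fine (Q (E i j)))%:E)%E.
  rewrite ge0_integral_sum// -sumEFin; apply: eq_bigr => j _.
  rewrite ge0_integralZl_EFin ?invr_ge0//; last 1 first.
  - exact: mEFin.
  by rewrite integral_indic// setIT EFinM fineK// fin_num_measure.
under eq_bigr do rewrite intE.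
rewrite sumEFin lee_fin; apply: (@le_trans _ _ (\sum_(i in N) c / n%:R)).
  apply: ler_sum => i; rewrite inE => /asboolP Hi.
  apply: null_contribution_le => //; first by move=> u u01; exact: pv.
  by move=> j jn s u; exact: d1.
by rewrite sumr_const -[leLHS]mulr_natl mulrA mulrAC.
Qed.

(** * Large proportions of rejections are asymptotically negligible *)

(** Almost sure convergence implies convergence in probability, for events. *)
Lemma cvg_measure_lim_sup_set0 Q (F : (set X)^nat) :
  (forall n, measurable (F n)) -> Q.-negligible (lim_sup_set F) ->
  Q (F n) @[n --> \oo] --> 0%E.
Proof.
move=> mF F0.
have mU n : measurable (\bigcup_(k >= n) F k) by exact: bigcup_measurable.
have Uoo : (Q (\bigcup_(k >= 0) F k) < +oo)%E.
  by rewrite (le_lt_trans (probability_le1 _ _)) ?ltry.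
have : Q (\bigcup_(k >= n) F k) @[n --> \oo] --> Q (lim_sup_set F).
  exact: lim_sup_set_cvg.
have -> : Q (lim_sup_set F) = 0%E.
  by apply/negligibleP => //; exact: bigcap_measurable.
apply: (@squeeze_cvge _ _ _ _ (cst 0%E)); last exact: cvg_cst.
apply: nearW => n; rewrite measure_ge0/=.
by apply: le_measure; rewrite ?inE//; by move=> x Fx; exists n => /=.
Qed.

Lemma limn_einf_gt_near (u : (\bar R)^nat) (l : \bar R) :
  (l < limn_einf u)%E -> \forall n \near \oo, (l < u n)%E.
Proof.
rewrite /limn_einf lteNr => /limf_esup_lt_near H.
by near do rewrite -lteN2; exact: H.
Unshelve. all: by end_near. Qed.

(** By (T2), R_n = j makes the empirical distribution function at rho(j / n)
    equal to j / n, which closes the gap assumed on [eps, 1] whenever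
    j >= eps * n. *)
Lemma cvg_many_rejections0 Q p (phi : forall n, mtp R n) (rho : R -> R) (eps : R) :
    0 < eps ->
    (forall n, (0 < n)%N -> T2 p (phi n) (crit_val rho n)) ->
    (\forall x \ae Q,
         (0 < limn_einf (fun n =>
            ereal_inf [set (t - ecdf p n x (rho t))%:E
                      | t in [set t : R | (eps <= t <= 1)%R]]))%E) ->
  Q [set x | (Num.truncn (eps * n%:R) < nrej p (phi n) x)%N] @[n --> \oo] --> 0%E.
Proof.
move=> eps0 t2 gap; apply: cvg_measure_lim_sup_set0 => [n|].
  exact: (measurable_nrej p n (phi n) (fun k => (Num.truncn _ < k)%N)).
apply: negligibleS gap => x /= Fx; apply/negP; rewrite -leNgt leNgt; apply/negP.
move=> /limn_einf_gt_near[N _ gapN].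
(* n >= 1 is needed to divide by n and to apply (T2) *)
have [n /= Nn] := Fx (maxn N 1) I; rewrite geq_max in Nn.
case/andP: Nn => Nn n0.
have nR : (0 : R) < n%:R by rewrite ltr0n.
set r := nrej _ _ _ => mr.
have r1n : (1 <= r <= n)%N.
  by rewrite (leq_ltn_trans _ mr)// -[X in (_ <= X)%N]card_ord; exact: max_card.
have epsr : eps * n%:R < r%:R.
  by move: mr; rewrite truncn_lt_nat// mulr_ge0// ltW.
have := gapN n Nn; rewrite ltNge => /negP; apply.
apply: ereal_inf_lbound; exists (r%:R / n%:R) => /=.
  rewrite ler_pdivlMr// (ltW epsr)/= ler_pdivrMr// mul1r ler_nat.
  by case/andP: r1n.
rewrite /ecdf (_ : [set i | _]%SET = rejected p (phi n) x); last first.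
  apply/setP => i; rewrite inE; apply/idP/idP => [h|h].
    exact/(t2 n n0 x r r1n erefl i).
  exact/(t2 n n0 x r r1n erefl i).
by rewrite subrr.
Qed.

End multiple_testing.

(** * The ratio rho(t) / t near 0 *)

Lemma limf_esup_q_right (R : realType) (rho : R -> R) :
  limf_esup (q rho) 0^'+ = q rho 0.
Proof.
rewrite {2}/q eqxx; apply/eqP; rewrite eq_le; apply/andP; split;
  apply: le_limf_esup; near=> t; rewrite /q gt_eqF//; near: t;
  exact: nbhs_right_gt.
Unshelve. all: by end_near. Qed.

Lemma qbar0 (R : realType) (rho : R -> R) : qbar rho 0 = q rho 0.
Proof. by rewrite /qbar set_itv1 image_set1 ereal_sup1. Qed.

(** f_alpha^-1(t) / t = alpha / (1 - (1 - alpha) t), which is at most alpha + e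
    as soon as t <= e / (1 + e). *)
Lemma q0_le (R : realType) (rho : R -> R) (alpha : R) : 0 < alpha < 1 ->
  (forall t : R, 0 <= t <= 1 -> rho t <= f_inv alpha t) ->
  (q rho 0 <= alpha%:E)%E.
Proof.
move=> /andP[alpha0 alpha1] rho_le; apply/lee_addgt0Pr => e e0.
rewrite /q eqxx; apply: limf_esup_le_near; near=> t.
have t0 : 0 < t by near: t; exact: nbhs_right_gt.
have te : t <= e / (1 + e) by near: t; apply: nbhs_right_le; rewrite divr_gt0// addr_gt0.
have {}te : t * (1 + e) <= e by rewrite -ler_pdivlMr// addr_gt0.
have t1 : t <= 1 by nra.
rewrite -EFinD lee_fin ler_pdivrMr//; apply: (le_trans (rho_le t _)).
  by rewrite (ltW t0).
have D0 : 0 < 1 - (1 - alpha) * t by nra.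
rewrite /f_inv ler_pdivrMr//.
have -> : (alpha + e) * t * (1 - (1 - alpha) * t) =
  t * ((alpha + e) * (1 - (1 - alpha) * t)) by ring.
rewrite mulrC ler_wpM2l ?(ltW t0)//.
have : (1 - alpha) * (t * (1 + e)) <= 1 * e.
  by rewrite ler_pM ?mulr_ge0//; lra.
have : (1 - alpha) * (t * (1 - alpha)) >= 0.
  by rewrite !mulr_ge0//; lra.
nra.
Unshelve. all: by end_near. Qed.

(** * The asymptotic bound *)

Theorem theorem5p3 (R : realType) (d : measure_display) (X : measurableType d)
    (Theta : Type) (P : Theta -> probability X R) (H : nat -> set Theta)
    (p : nat -> {mfun X >-> R})
    (Pzero : Theta -> nat -> probability X R) (PDU : set nat -> probability X R)
    (phi : forall n : nat, mtp R n) (rho : R -> R)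
    (alpha zeta : R) (theta : Theta)
    (H_nonempty : forall i, H i !=set0)
    (p_pvalues : is_pvalues P H p)
    (PDU_dirac_uniform : forall I, is_dirac_uniform p I (PDU I))
    (Pzero_zeroed : forall vartheta i, H i vartheta ->
       is_zeroed p (P vartheta) i (Pzero vartheta i))
    (alpha01 : 0 < alpha < 1)
    (rho_cvf : is_cvf rho)
    (rho_le : forall t : R, 0 <= t <= 1 -> rho t <= f_inv alpha t)
    (hT1 : forall n, (0 < n)%N -> T1 p (phi n) (crit_val rho n))
    (hT2 : forall n, (0 < n)%N -> T2 p (phi n) (crit_val rho n))
    (hD1 : forall n, (0 < n)%N -> D1 P H p (phi n) (crit_val rho n))
    (hD2 : forall n, (0 < n)%N -> D2 P H Pzero p (phi n) (crit_val rho n))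
    (hD3 : forall n, (0 < n)%N -> D3 P H p n)
    (hI1 : forall n, (0 < n)%N -> I1 P H p n)
    (hI2 : forall n, (0 < n)%N -> I2 P H p n)
    (hA1 : forall n, (0 < n)%N -> A1 P H Pzero PDU p (phi n))
    (zeta01 : 0 <= zeta <= 1)
    (zeta_lim : (fun n => zeta_ R H theta n) @ \oo --> zeta)
    (ecdf_lt : forall eps : R, 0 < eps ->
       \forall x \ae P theta,
         (0 < limn_einf (fun n =>
            ereal_inf [set (t - ecdf p n x (rho t))%:E
                      | t in [set t : R | (eps <= t <= 1)%R]]))%E) :
  [/\ (limn_esup (fun n => FDR P H p (phi n) theta)
        <= zeta%:E * limf_esup (q rho) 0^'+)%E,
      (zeta%:E * limf_esup (q rho) 0^'+ = zeta%:E * q rho 0)%E,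
      (zeta%:E * q rho 0 = zeta%:E * qbar rho 0)%E
    & (zeta%:E * qbar rho 0 <= (zeta * alpha)%:E)%E].
Proof.
have [_ ndrho rho01 [_ rho_gt0] q0fin] := rho_cvf.
have zeta0 : 0 <= zeta by case/andP: zeta01.
rewrite qbar0 limf_esup_q_right; split => //; last first.
  by rewrite EFinM lee_wpmul2l ?lee_fin//; exact: q0_le.
rewrite -(fineK q0fin) -EFinM; set q0 := fine _.
apply/lee_addgt0Pr => e e0.
have q0_ge0 : 0 <= q0.
  apply: fine_ge0; rewrite /q eqxx; apply: le_ereal_inf_tmp => _ [V V0 <-].
  have [t [Vt t01]] : exists t, V t /\ 0 < t <= 1.
    have : \forall t \near (0 : R)^'+, V t /\ 0 < t <= 1.
      near=> t; split; first by near: t.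
      apply/andP; split; near: t; [exact: nbhs_right_gt|exact: nbhs_right_le].
    by move=> /filter_ex.
  apply: (@le_trans _ _ (rho t / t)%:E); last by apply: ereal_sup_ubound; exists t.
  by case/andP: (t01) => t0 _; rewrite lee_fin divr_ge0 ?ltW// rho_gt0.
have [eps [eps0 eps1 rho_eps]] : exists eps : R,
    [/\ 0 < eps, eps < 1 & forall t, 0 < t <= eps -> rho t <= (q0 + e) * t].
  have : (q rho 0 < (q0 + e)%:E)%E by rewrite -(fineK q0fin) lte_fin ltrDl.
  rewrite -limf_esup_q_right => /limf_esup_lt_near [r /= r0 qr].
  (* r / 2 keeps the closed interval inside the ball of radius r, and eps < 1
     makes the threshold m n below at most n *)
  exists (Num.min (r / 2) (1 / 2)); split.
  - by rewrite lt_min !divr_gt0.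
  - by rewrite gt_min; apply/orP; right; lra.
  - move=> t /andP[t0]; rewrite le_min => /andP[tr _].
    have /= := qr t _ t0; rewrite /q gt_eqF// lte_fin => qt.
    rewrite -ler_pdivrMr//; apply/ltW/qt.
    by rewrite /= sub0r normrN gtr0_norm//; lra.
(* j < m n iff j <= eps * n, so m n <= R_n iff R_n > eps * n *)
pose m n := (Num.truncn (eps * n%:R)).+1.
have c0 : 0 <= q0 + e by rewrite addr_ge0 ?(ltW e0).
have bound n : (0 < n)%N -> (FDR P H p (phi n) theta <=
    (zeta_ R H theta n * (q0 + e))%:E +
    P theta [set x | (m n <= nrej p (phi n) x)%N])%E.
  move=> n0; have nR : (0 : R) < n%:R by rewrite ltr0n.
  have jn01 j : (j <= n)%N -> 0 <= (j%:R / n%:R : R) <= 1.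
    by move=> jn; rewrite divr_ge0//= ler_pdivrMr// mul1r ler_nat.
  apply: (@FDR_le _ _ _ _ _ _ _ _ _ (crit_val rho n)) => //.
  - exact: hT2.
  - exact: hD1.
  - move=> j /andP[j0 jn]; have /andP[? jn1] := jn01 _ jn.
    by rewrite /crit_val rho_gt0 ?divr_gt0 ?ltr0n//=; case/andP: (rho01 _ (jn01 _ jn)).
  - move=> j /andP[j0 jn]; have /andP[? _] := jn01 _ (ltnW jn).
    have /andP[_ ?] := jn01 _ jn; apply: ndrho => //.
    by rewrite ler_pM2r ?invr_gt0// ler_nat.
  - by rewrite /m /= truncn_lt_nat ?mulr_ge0 ?(ltW eps0)// gtr_pMl.
  - move=> j /andP[j0]; rewrite ltnS => jm; apply: rho_eps.
    rewrite divr_gt0 ?ltr0n//= ler_pdivrMr//.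
    apply: (@le_trans _ _ (Num.truncn (eps * n%:R))%:R); first by rewrite ler_nat.
    by rewrite truncn_le// mulr_ge0 ?(ltW eps0).
have lim : (zeta_ R H theta n * (q0 + e))%:E +
    P theta [set x | (m n <= nrej p (phi n) x)%N] @[n --> \oo] -->
    ((zeta * (q0 + e))%:E + 0)%E.
  apply: cvgeD => //; last exact: (cvg_many_rejections0 _ _ _ _ _ eps0 hT2 (ecdf_lt _ eps0)).
  by apply: cvg_EFin; [exact: nearW|apply: cvgM => //; exact: cvg_cst].
apply: (@le_trans _ _ ((zeta * (q0 + e))%:E + 0)%E); last first.
  rewrite adde0 -EFinD lee_fin mulrDr lerD2l ler_piMl// ?(ltW e0)//.
  by case/andP: zeta01.
rewrite -(cvg_limn_einf_sup lim).2; apply: le_limf_esup.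
by exists 1%N => // n /= n0; exact: bound.
Unshelve. all: by end_near. Qed.
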